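(* Let $L>0$, let $W(v)=\frac14(v^2-1)^2$, and let $u$ be a nontrivial (i.e. nonconstant) $L$-periodic solution with zero average of $$\Delta^2(\Delta u-W'(u))=0.$$ Let $\mathcal{L}_uw=\Delta^2(\Delta w-W''(u)w)$. Then the only $L$-periodic solutions $w$ of $\mathcal{L}_uw=0$ with zero mean value are the multiples of $u_x$.
   Context: Functions are of one real variable $x$, $\Delta=\partial_x^2$, $\Delta^2=\partial_x^4$; solutions are smooth and periodic with period $L$ (all derivatives periodic). *)

(* Defs.v *)
From Stdlib Require Import Reals.
From Coquelicot Require Import Coquelicot.

Open Scope R_scope.

Definition smooth (f : R -> R) : Prop :=
  forall (n : nat) (x : R), ex_derive_n f n x.

(* L is a period, not necessarily the minimal one; for smooth f the
   derivatives of every order are then L-periodic as well. *)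
Definition periodic (L : R) (f : R -> R) : Prop :=
  forall x : R, f (x + L) = f x.

Definition average (L : R) (f : R -> R) : R := / L * RInt f 0 L.

Definition nonconstant (f : R -> R) : Prop :=
  ~ exists c : R, forall x : R, f x = c.

Definition Delta (f : R -> R) : R -> R := Derive_n f 2.

Definition Delta2 (f : R -> R) : R -> R := Derive_n f 4.

Definition W (v : R) : R := 1 / 4 * (v ^ 2 - 1) ^ 2.

Definition stationary_solution (u : R -> R) : Prop :=
  forall x : R, Delta2 (fun y => Delta u y - Derive W (u y)) x = 0.

Definition linearized (u w : R -> R) : R -> R :=
  Delta2 (fun y => Delta w y - Derive_n W 2 (u y) * w y).

(* Main.v *)
Require Import Defs.
From Stdlib Require Import Reals Lra Lia Psatz.
From Coquelicot Require Import Coquelicot.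

Open Scope R_scope.

(** A periodic function with vanishing fourth derivative is constant, so the
    equations reduce to [u'' = u^3 - u + c] and [w'' = (3 u^2 - 1) w + d].  The function
    [arcsinh (u' / sqrt (kappa * G))], with [G] the regular factor of the first
    integral, is periodic and its derivative compares the mean of [u] with the
    midpoint [s / 2] of its range; zero mean forces [s = 0], hence [c = 0] and
    [|u| < 1].  For [c = 0] all solutions of the linear equation are elementary:
    [1 - u^2] solves it with [d = 1 - e4], and the homogeneous equation is
    spanned by [u'] and [zeta = S u' - u^3 + (2 - e4) u] with [S' = u^2 - e4],
    where [e4 = 2 u'^2 + 2 u^2 - u^4].  Since [u^2 < e4], [S] is not periodic,
    so [zeta] drops out; since [1 - u^2 > 0], zero mean gives [d = 0]. *)

(* [is_derive] goals for compositions of functions whose derivative is given by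
   a hypothesis [forall x, is_derive f x _]. *)
Ltac derive_known :=
  auto_derive;
  [ repeat split;
    match goal with
    | H : forall x, is_derive ?f x _ |- ex_derive ?g _ =>
        unify f g; eexists; apply H
    | _ => idtac
    end
  | repeat match goal with
      | H : forall x, is_derive ?f x _ |- context [Derive ?g ?t] =>
          unify f g; rewrite (is_derive_unique g t _ (H t))
      end ].

(** * Consequences of the mean value theorem *)

Lemma is_derive_Rolle (f f' : R -> R) (a b : R) :
  (forall x, is_derive f x (f' x)) -> a < b -> f a = f b ->
  exists xi, f' xi = 0.
Proof.
intros Hf Hab Heq.
destruct (MVT_cor2 f f' a b Hab) as [xi [Hxi _]].
{ intros x _. apply is_derive_Reals, Hf. }
exists xi. apply (Rmult_eq_reg_r (b - a)); lra.
Qed.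

Lemma is_derive_0_const (f : R -> R) :
  (forall x, is_derive f x 0) -> forall x y, f x = f y.
Proof.
intros Hf x y.
destruct (MVT_gen f x y (fun _ => 0)) as [xi [_ Hxi]].
- intros t _. apply Hf.
- intros t _. apply continuity_pt_filterlim, (ex_derive_continuous f t).
  eexists; apply Hf.
- lra.
Qed.

(** * Closure properties of smooth functions *)

Lemma smooth_is_derive (f : R -> R) :
  smooth f -> forall x, is_derive f x (Derive f x).
Proof. intros Hf x. apply Derive_correct, (Hf 1%nat x). Qed.

Lemma Derive_n_Derive (f : R -> R) (n : nat) (x : R) :
  Derive_n (Derive f) n x = Derive_n f (S n) x.
Proof.
rewrite (Derive_n_comp f n 1). now replace (n + 1)%nat with (S n) by lia.
Qed.

Lemma ex_derive_n_Derive (f : R -> R) (n : nat) (x : R) :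
  ex_derive_n f (S (S n)) x <-> ex_derive_n (Derive f) (S n) x.
Proof.
simpl. split; apply ex_derive_ext; intros t;
  [ symmetry | ]; apply (Derive_n_Derive f n t).
Qed.

Lemma smooth_Derive (f : R -> R) : smooth f -> smooth (Derive f).
Proof.
intros Hf [|n] x; [exact I|]. apply (proj1 (ex_derive_n_Derive f n x)), Hf.
Qed.

Lemma smooth_ext (f g : R -> R) :
  (forall x, f x = g x) -> smooth f -> smooth g.
Proof. intros Hfg Hf n x. now apply (ex_derive_n_ext f g). Qed.

Lemma smooth_const (c : R) : smooth (fun _ => c).
Proof. intros n x. apply ex_derive_n_const. Qed.

Lemma smooth_plus (f g : R -> R) :
  smooth f -> smooth g -> smooth (fun x => f x + g x).
Proof.
intros Hf Hg n x.
apply ex_derive_n_plus; apply filter_forall; intros y k _; [apply Hf | apply Hg].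
Qed.

Lemma smooth_mult (f g : R -> R) :
  smooth f -> smooth g -> smooth (fun x => f x * g x).
Proof.
intros Hf Hg n.
(* The induction covers all orders up to [n] and all pairs of factors: the product rule changes the
   factors, and [ex_derive_n_plus] asks for every lower order as well. *)
enough (H : forall m, (m <= n)%nat -> forall f g, smooth f -> smooth g ->
  forall x, ex_derive_n (fun x => f x * g x) m x).
{ intros x. now apply (H n (le_n n) f g). }
clear f g Hf Hg.
induction n as [|n IH]; intros m Hm f g Hf Hg x.
- replace m with 0%nat by lia. exact I.
- destruct (Nat.eq_dec m (S n)) as [->|Hne]; [|apply IH; trivial; lia].
  destruct n as [|n].
  + apply (ex_derive_mult f g); eexists; now apply smooth_is_derive.
  + apply (proj2 (ex_derive_n_Derive _ n x)).
    apply (ex_derive_n_ext (fun t => Derive f t * g t + f t * Derive g t)).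
    { intros t. symmetry. apply is_derive_unique.
      apply (is_derive_mult f g); [now apply smooth_is_derive ..|].
      intros; apply Rmult_comm. }
    apply ex_derive_n_plus; apply filter_forall; intros y k Hk;
      apply IH; trivial; now apply smooth_Derive.
Qed.

Lemma smooth_scal (c : R) (f : R -> R) : smooth f -> smooth (fun x => c * f x).
Proof. intros Hf. apply smooth_mult; [apply smooth_const|easy]. Qed.

Lemma smooth_minus (f g : R -> R) :
  smooth f -> smooth g -> smooth (fun x => f x - g x).
Proof.
intros Hf Hg. apply (smooth_ext (fun x => f x + -1 * g x)); [intros; ring|].
apply smooth_plus; trivial. now apply smooth_scal.
Qed.

Lemma smooth_sqr (f : R -> R) : smooth f -> smooth (fun x => f x ^ 2).
Proof.
intros Hf. apply (smooth_ext (fun x => f x * f x)); [intros; ring|].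
now apply smooth_mult.
Qed.

(** * Periodic functions *)

Lemma periodic_Derive (L : R) (f : R -> R) :
  smooth f -> periodic L f -> periodic L (Derive f).
Proof.
intros Hs Hf x. symmetry. apply is_derive_unique.
apply (is_derive_ext (fun t => f (t + L))); [exact Hf|].
auto_derive; [|now rewrite Rmult_1_l].
eexists; now apply smooth_is_derive.
Qed.

Lemma is_derive_Delta (f : R -> R) (x : R) :
  smooth f -> is_derive (Derive f) x (Defs.Delta f x).
Proof.
intros Hf. apply (smooth_is_derive (Derive f)). now apply smooth_Derive.
Qed.

Lemma smooth_Delta (f : R -> R) : smooth f -> smooth (Defs.Delta f).
Proof. intros Hf. now apply (smooth_Derive (Derive f)), smooth_Derive. Qed.

Lemma periodic_Delta (L : R) (f : R -> R) :
  smooth f -> periodic L f -> periodic L (Defs.Delta f).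
Proof.
intros Hs Hf. apply (periodic_Derive L (Derive f)).
- now apply smooth_Derive.
- now apply periodic_Derive.
Qed.

(** By induction [Derive g] is constant, and Rolle over one period gives it a zero, so it vanishes
    identically. *)
Lemma smooth_periodic_Derive_n_0 (L : R) (n : nat) (g : R -> R) :
  0 < L -> smooth g -> periodic L g ->
  (forall x, Derive_n g n x = 0) -> forall x y, g x = g y.
Proof.
intros HL. revert g. induction n as [|n IH]; intros g Hs Hp Hn x y.
- simpl in Hn. now rewrite !Hn.
- assert (Hc : forall x y, Derive g x = Derive g y).
  { apply IH; [now apply smooth_Derive|now apply periodic_Derive|].
    intros t. now rewrite Derive_n_Derive. }
  destruct (is_derive_Rolle g (Derive g) 0 L) as [xi Hxi]; trivial.
  + now apply smooth_is_derive.
  + now rewrite <- (Hp 0), Rplus_0_l.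
  + apply is_derive_0_const. intros t.
    rewrite <- Hxi, (Hc xi t). now apply smooth_is_derive.
Qed.

Lemma periodic_shift (L : R) (f : R -> R) (n : nat) :
  periodic L f -> forall x, f (x + INR n * L) = f x.
Proof.
intros Hf. induction n as [|n IH]; intros x.
- simpl. f_equal; ring.
- rewrite S_INR. replace (x + (INR n + 1) * L) with (x + INR n * L + L) by ring.
  now rewrite Hf.
Qed.

Lemma periodic_representative (L : R) (f : R -> R) (x : R) :
  0 < L -> periodic L f -> exists y, 0 <= y <= L /\ f x = f y.
Proof.
intros HL Hf.
(* A first shift by [m] periods makes the argument positive, since [nfloor_ex] needs a nonnegative
   number. *)
destruct (INR_unbounded (- x / L)) as [m Hm].
assert (Hxm : 0 < x + INR m * L).
{ apply (Rmult_lt_compat_r L) in Hm; trivial.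
  replace (- x / L * L) with (- x) in Hm by (field; lra). lra. }
destruct (nfloor_ex ((x + INR m * L) / L)) as [n [Hn1 Hn2]].
{ apply Rlt_le. now apply Rdiv_lt_0_compat. }
exists (x + INR m * L - INR n * L).
assert (Hq : x + INR m * L = (x + INR m * L) / L * L) by (field; lra).
split.
- apply (Rmult_le_compat_r L) in Hn1; [|lra].
  apply (Rmult_lt_compat_r L) in Hn2; lra.
- rewrite <- (periodic_shift L f m Hf x).
  rewrite <- (periodic_shift L f n Hf (_ - _)). f_equal. ring.
Qed.

Lemma periodic_maximum (L : R) (f : R -> R) :
  0 < L -> periodic L f -> (forall x, continuity_pt f x) ->
  exists x0, forall x, f x <= f x0.
Proof.
intros HL Hp Hc.
destruct (continuity_ab_maj f 0 L) as [x0 [H0 _]]; [lra|auto|].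
exists x0. intros x.
destruct (periodic_representative L f x HL Hp) as [y [Hy ->]]. auto.
Qed.

(** * Maxima and a Gronwall argument *)

(** If [l] were positive, [f1] would be positive just to the right of [x0], and the mean value
    theorem would give a value above the maximum. *)
Lemma maximum_second_derive (f f1 : R -> R) (x0 l : R) :
  (forall x, is_derive f x (f1 x)) -> is_derive f1 x0 l ->
  (forall x, f x <= f x0) -> f1 x0 = 0 /\ l <= 0.
Proof.
intros Hf Hf1 Hmax.
assert (H0 : f1 x0 = 0).
{ destruct (is_derive_Reals f x0 (f1 x0)) as [Hd _].
  specialize (Hd (Hf x0)).
  assert (H := deriv_maximum f (x0 - 1) (x0 + 1) x0 (exist _ _ Hd)).
  rewrite (derive_pt_eq_0 f x0 (f1 x0)) in H; trivial.
  apply H; try lra; auto. }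
split; trivial.
apply Rnot_lt_le. intros Hl.
apply is_derive_Reals in Hf1.
destruct (Hf1 (l / 2)) as [d Hd]; [lra|].
assert (Hdp := cond_pos d).
destruct (MVT_cor2 f f1 x0 (x0 + d / 2)) as [xi [Heq Hxi]]; [lra| |].
{ intros x _. apply is_derive_Reals, Hf. }
specialize (Hmax (x0 + d / 2)).
specialize (Hd (xi - x0)).
rewrite Rabs_pos_eq in Hd by lra.
replace (x0 + (xi - x0)) with xi in Hd by ring.
assert (H1 := Hd ltac:(lra) ltac:(lra)).
apply Rabs_def2 in H1. rewrite H0 in H1.
assert (H2 : 0 < (f1 xi - 0) / (xi - x0)) by lra.
assert (H3 : f1 xi = (f1 xi - 0) / (xi - x0) * (xi - x0)) by (field; lra).
assert (0 < f1 xi) by (rewrite H3; apply Rmult_lt_0_compat; lra).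
nra.
Qed.

(** The function [f ^ 2 * exp (2 * C * x)] is nondecreasing and [f ^ 2 * exp (- (2 * C) * x)]
    nonincreasing, so the zero at [x0] spreads to the left through the first and to the right
    through the second. *)
Lemma gronwall_zero (f f' : R -> R) (C x0 : R) :
  (forall x, is_derive f x (f' x)) -> (forall x, (f' x) ^ 2 <= (C * f x) ^ 2) ->
  0 < C -> f x0 = 0 -> forall x, f x = 0.
Proof.
intros Hf Hb HC H0.
assert (Hup : forall x, 2 * C * (f x) ^ 2 + 2 * f x * f' x >= 0 /\
  2 * C * (f x) ^ 2 - 2 * f x * f' x >= 0).
{ intros x. specialize (Hb x).
  assert (Rabs (f x * f' x) <= C * f x ^ 2).
  { rewrite <- (Rabs_pos_eq (C * f x ^ 2)) by (assert (0 <= f x ^ 2) by apply pow2_ge_0; nra).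
    apply Rsqr_le_abs_0. unfold Rsqr. assert (0 <= f x ^ 2) by apply pow2_ge_0. nra. }
  apply Rabs_le_between in H. lra. }
assert (Hd : forall k y, is_derive (fun x => (f x) ^ 2 * exp (k * x)) y
   ((k * (f y) ^ 2 + 2 * f y * f' y) * exp (k * y))).
{ intros k y. derive_known. ring. }
intros x.
enough (f x ^ 2 <= 0) by (assert (0 <= f x ^ 2) by apply pow2_ge_0; nra).
destruct (Rtotal_order x x0) as [Hx|[->|Hx]]; [|rewrite H0; lra|].
- destruct (MVT_cor2 _ _ x x0 Hx (fun c _ => proj1 (is_derive_Reals _ _ _) (Hd (2 * C) c)))
    as [xi [Heq _]].
  rewrite H0 in Heq. destruct (Hup xi) as [H1 _].
  assert (He := exp_pos (2 * C * x)). assert (He' := exp_pos (2 * C * xi)).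
  assert (0 <= (2 * C * f xi ^ 2 + 2 * f xi * f' xi) * exp (2 * C * xi) * (x0 - x)).
  { repeat apply Rmult_le_pos; lra. }
  nra.
- destruct (MVT_cor2 _ _ x0 x Hx (fun c _ => proj1 (is_derive_Reals _ _ _) (Hd (- (2 * C)) c)))
    as [xi [Heq _]].
  rewrite H0 in Heq. destruct (Hup xi) as [_ H1].
  assert (He := exp_pos (- (2 * C) * x)). assert (He' := exp_pos (- (2 * C) * xi)).
  assert (0 <= (2 * C * f xi ^ 2 - 2 * f xi * f' xi) * exp (- (2 * C) * xi) * (x - x0)).
  { repeat apply Rmult_le_pos; lra. }
  nra.
Qed.

(** * Orbits of the nonlinear second-order equation *)

Lemma first_integral (u u1 : R -> R) (c : R) :
  (forall x, is_derive u x (u1 x)) ->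
  (forall x, is_derive u1 x (u x ^ 3 - u x + c)) ->
  forall x y, 2 * u1 x ^ 2 - u x ^ 4 + 2 * u x ^ 2 - 4 * c * u x
            = 2 * u1 y ^ 2 - u y ^ 4 + 2 * u y ^ 2 - 4 * c * u y.
Proof.
intros Hu Hu1.
apply (is_derive_0_const
  (fun x => 2 * u1 x ^ 2 - u x ^ 4 + 2 * u x ^ 2 - 4 * c * u x)).
intros t. derive_known. ring.
Qed.

(* If [x0] were an equilibrium, the first integral would have a double root at
   [u x0], so [|u'| <= C |u - u x0|] and [u] would be constant by Gronwall. *)
Lemma maximum_simple_root (u u1 : R -> R) (c x0 B : R) :
  (forall x, is_derive u x (u1 x)) ->
  (forall x, is_derive u1 x (u x ^ 3 - u x + c)) ->
  (forall x, u x <= u x0) -> (forall x, - B <= u x) -> nonconstant u ->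
  u1 x0 = 0 /\ u x0 ^ 3 - u x0 + c < 0.
Proof.
intros Hu Hu1 Hmax HB Hnc.
destruct (maximum_second_derive u u1 x0 _ Hu (Hu1 x0) Hmax) as [H0 Hle].
split; trivial. destruct Hle as [|Heq]; trivial. exfalso. apply Hnc.
exists (u x0). intros x.
assert (Hfi := fun y => first_integral u u1 c Hu Hu1 y x0).
set (P := u x0) in *.
assert (HPB : - B <= P) by apply HB.
enough (u x - P = 0) by lra.
(* [C] bounds both [|u|] and [|P|], so the quadratic cofactor of [(u - P) ^ 2] in [2 * u1 ^ 2] is at
   most [6 * C ^ 2]; the Gronwall constant [2 * C] then suffices. *)
set (C := Rabs P + Rabs B + 1).
assert (HC : 0 < C) by (unfold C; assert (H := Rabs_pos P); assert (H' := Rabs_pos B); lra).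
apply (gronwall_zero (fun x => u x - P) u1 (2 * C) x0); [| |lra|unfold P; ring].
- intros t. derive_known. ring.
- intros t. specialize (Hfi t). specialize (HB t). specialize (Hmax t).
  assert (Hsq : 2 * u1 t ^ 2 = (u t - P) ^ 2 * (u t ^ 2 + 2 * P * u t + 3 * P ^ 2 - 2)).
  { replace c with (P - P ^ 3) in Hfi by lra. rewrite H0 in Hfi. nra. }
  assert (Hut : Rabs (u t) <= C).
  { unfold C. apply Rabs_le. assert (H := Rle_abs P). assert (H' := Rle_abs B).
    assert (Hq := Rabs_pos P). assert (Hq' := Rabs_pos B). lra. }
  assert (HPC : Rabs P <= C) by (unfold C; assert (H' := Rabs_pos B); lra).
  apply Rabs_le_between in Hut. apply Rabs_le_between in HPC.
  assert (u t ^ 2 <= C ^ 2) by nra. assert (P ^ 2 <= C ^ 2) by nra.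
  assert (2 * P * u t <= 2 * C ^ 2) by (assert (0 <= (P - u t)^2) by apply pow2_ge_0; nra).
  assert (Hs := pow2_ge_0 (u t - P)).
  rewrite Rpow_mult_distr. nra.
Qed.

Lemma is_derive_primitive (f : R -> R) :
  (forall x, continuous f x) -> forall x, is_derive (fun x => RInt f 0 x) x (f x).
Proof.
intros Hc x. apply (is_derive_RInt f _ 0); [|apply Hc].
apply filter_forall. intros y. apply (RInt_correct f).
apply (ex_RInt_continuous f). intros; apply Hc.
Qed.

(** The mean condition becomes equality of the primitive at both ends of a period, ready for
    Rolle. *)
Lemma zero_average_primitive (L : R) (f : R -> R) :
  0 < L -> (forall x, continuous f x) -> average L f = 0 ->
  (forall x, is_derive (fun x => RInt f 0 x) x (f x)) /\ RInt f 0 L = RInt f 0 0.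
Proof.
intros HL Hc Ha. split; [now apply is_derive_primitive|].
rewrite RInt_point. unfold average in Ha.
apply (Rmult_eq_reg_l (/ L)); [|now apply Rinv_neq_0_compat, Rgt_not_eq].
rewrite Ha. symmetry. apply Rmult_0_r.
Qed.

Lemma zero_average_orbit (L : R) (u u1 : R -> R) (c : R) :
  0 < L -> (forall x, is_derive u x (u1 x)) ->
  (forall x, is_derive u1 x (u x ^ 3 - u x + c)) ->
  periodic L u -> periodic L u1 -> nonconstant u -> average L u = 0 ->
  c = 0 /\ exists e4, 0 < e4 < 1 /\ (forall x, u x ^ 2 < e4) /\
    forall x, 2 * u1 x ^ 2 = u x ^ 4 - 2 * u x ^ 2 + e4.
Proof.
intros HL Hu Hu1 Hp Hp1 Hnc Ha.
assert (Hcont : forall x, continuous u x).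
{ intros x. apply (ex_derive_continuous u). eexists; apply Hu. }
assert (Hcont' : forall x, continuity_pt u x).
{ intros x. apply continuity_pt_filterlim, Hcont. }
destruct (periodic_maximum L u HL Hp Hcont') as [xP HP].
destruct (periodic_maximum L (fun x => - u x)) as [xQ HQ]; trivial.
{ intros x. now rewrite Hp. }
{ intros x. apply (continuity_pt_opp u). apply Hcont'. }
assert (HQ' : forall x, u xQ <= u x) by (intros x; specialize (HQ x); lra).
destruct (maximum_simple_root u u1 c xP (- u xQ)) as [H1P HPneg]; trivial.
{ intros x. specialize (HQ' x). lra. }
(* The minimum of [u] is the maximum of [- u], which solves the same equation with [- c]. *)
destruct (maximum_simple_root (fun x => - u x) (fun x => - u1 x) (- c) xQ (u xP))
  as [H1Q HQpos]; trivial.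
{ intros x. apply (is_derive_opp u). apply Hu. }
{ intros x. replace ((- u x) ^ 3 - - u x + - c) with (- (u x ^ 3 - u x + c)) by ring.
  apply (is_derive_opp u1). apply Hu1. }
{ intros x. specialize (HP x). lra. }
{ intros [k Hk]. apply Hnc. exists (- k). intros x. specialize (Hk x). lra. }
assert (H1Q' : u1 xQ = 0) by lra.
assert (HfiP : forall x, 2 * u1 x ^ 2 - u x ^ 4 + 2 * u x ^ 2 - 4 * c * u x
  = - u xP ^ 4 + 2 * u xP ^ 2 - 4 * c * u xP).
{ intros x. rewrite (first_integral u u1 c Hu Hu1 x xP), H1P. ring. }
assert (HfiQ := HfiP xQ). rewrite H1Q' in HfiQ.
set (P := u xP) in *. set (Q := u xQ) in *.
assert (HQP : Q < P).
{ destruct (HQ' xP) as [|Heq]; trivial. fold P in Heq. rewrite Heq in HQpos. lra. }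
set (s := P + Q).
(* Since [u1] vanishes at both extrema, equating the first integral there and dividing by [P - Q]
   determines [c]. *)
assert (Hc : 4 * c = s * (2 * P * Q + 2 - s ^ 2)).
{ apply (Rmult_eq_reg_l (P - Q)); [|lra]. unfold s. nra. }
(* With this value of [c], four times [P ^ 3 - P + c] is [P - Q] times the left side; the next
   inequality comes likewise from [Q]. They say that the regular factor is positive at [u = P] and
   at [u = Q]. *)
assert (HRP : 3 * P ^ 2 + 2 * P * Q + Q ^ 2 - 2 < 0).
{ apply (Rmult_lt_reg_l (P - Q)); [lra|]. unfold s in Hc. nra. }
assert (HRQ : 3 * Q ^ 2 + 2 * P * Q + P ^ 2 - 2 < 0).
{ apply (Rmult_lt_reg_l (P - Q)); [lra|]. unfold s in Hc. nra. }
(* [2 * u1 ^ 2 = (P - u) * (u - Q) * G2 (u - s / 2)], and [A] is the part of [G2]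
   even in its argument. *)
set (G2 := fun v => 2 + P * Q - 3 * s ^ 2 / 4 - (v + s) ^ 2).
set (A := fun v => G2 v + 2 * s * v).
(* The common value of [A] at [u = P] and [u = Q], which is also the mean of the values of [G2]
   there. *)
set (kappa := 2 + P * Q - 3 * s ^ 2 / 4 - s ^ 2 - ((P - Q) / 2) ^ 2).
assert (Hkappa : 0 < kappa) by (unfold kappa, s; lra).
assert (HG2 : forall x, 0 < G2 (u x - s / 2)).
{ intros x. specialize (HP x). specialize (HQ' x). unfold G2, s.
  apply (Rmult_lt_reg_l (P - Q)); [lra|]. rewrite Rmult_0_r.
  (* [G2] is a concave quadratic in [u]: linear interpolation between its positive end values plus a
     nonnegative term. *)
  replace ((P - Q) * _) with
    ((u x - Q) * (- (3 * P ^ 2 + 2 * P * Q + Q ^ 2 - 2))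
     + (P - u x) * (- (3 * Q ^ 2 + 2 * P * Q + P ^ 2 - 2))
     + (P - Q) * ((P - u x) * (u x - Q))) by field.
  assert (H1 : 0 <= (P - Q) * ((P - u x) * (u x - Q)))
    by (repeat apply Rmult_le_pos; lra).
  apply Rplus_lt_le_0_compat; trivial.
  destruct HQ' as [HQ'|HQ'].
  - apply Rplus_lt_le_0_compat; [apply Rmult_lt_0_compat|apply Rmult_le_pos]; lra.
  - apply Rplus_le_lt_0_compat; [apply Rmult_le_pos|apply Rmult_lt_0_compat]; lra. }
assert (HA : forall x, A (u x - s / 2) = kappa + (P - u x) * (u x - Q)).
{ intros x. unfold A, G2, kappa, s. field. }
assert (HApos : forall x, 0 < A (u x - s / 2)).
{ intros x. rewrite HA. specialize (HP x). specialize (HQ' x).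
  assert (0 <= (P - u x) * (u x - Q)) by (apply Rmult_le_pos; lra). lra. }
assert (Hu1sq : forall x, 2 * u1 x ^ 2 = (P - u x) * (u x - Q) * G2 (u x - s / 2)).
{ intros x. specialize (HfiP x). unfold G2.
  enough (H : 2 * u1 x ^ 2 = u x ^ 4 - 2 * u x ^ 2 - P ^ 4 + 2 * P ^ 2 + 4 * c * (u x - P))
    by (rewrite H, Hc; unfold s; field).
  lra. }
(* With [v = u - s / 2], the second term of [Phi] has derivative
   [- v * sqrt (G2 v / A v)], and [A v - G2 v = 2 * s * v]. *)
set (Phi := fun x => RInt u 0 x
   + sqrt 2 * arcsinh (sqrt 2 * u1 x / sqrt (kappa * G2 (u x - s / 2)))).
set (rho := fun x => 1 / 2 + 2 * (u x - s / 2) ^ 2 /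
   (sqrt (A (u x - s / 2)) * (sqrt (A (u x - s / 2)) + sqrt (G2 (u x - s / 2))))).
destruct (zero_average_primitive L u HL Hcont Ha) as [HU HUL].
assert (HPhi : forall x, is_derive Phi x (s * rho x)).
{ intros x. unfold Phi.
  assert (HGx := HG2 x). assert (HAx := HApos x). assert (HuA := HA x).
  assert (Hsq := Hu1sq x). set (v := u x - s / 2) in *.
  (* A quarter of the derivative in [u] of the factored form of [2 * u1 ^ 2]. *)
  assert (Hu2 : u x ^ 3 - u x + c
      = - v * G2 v / 2 - (P - u x) * (u x - Q) * (v + s) / 2).
  { replace c with (s * (2 * P * Q + 2 - s ^ 2) / 4) by lra.
    unfold G2, v, s. field. }
  set (t := sqrt 2). set (k := sqrt kappa). set (g := sqrt (G2 v)).
  assert (Ht0 : 0 < t) by (apply sqrt_lt_R0; lra).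
  assert (Hk0 : 0 < k) by now apply sqrt_lt_R0.
  assert (Hg0 : 0 < g) by now apply sqrt_lt_R0.
  assert (Ht : t ^ 2 = 2) by (apply pow2_sqrt; lra).
  assert (Hk : k ^ 2 = kappa) by (apply pow2_sqrt; lra).
  assert (Hg : g ^ 2 = G2 v) by (apply pow2_sqrt; lra).
  assert (Hr : is_derive (fun x => sqrt 2 * u1 x / sqrt (kappa * G2 (u x - s / 2))) x
     (- v * sqrt (G2 v) / (sqrt 2 * sqrt kappa))).
  { assert (HGe : 2 + P * Q - 3 * (s * (s * 1)) / 4 +
        - ((u x + - (s / 2) + s) * ((u x + - (s / 2) + s) * 1)) = G2 v)
      by (unfold G2, v; simpl; field).
    unfold G2 at 1. derive_known; rewrite HGe, ?sqrt_mult by lra; fold t k g.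
    - now apply Rmult_lt_0_compat.
    - apply Rgt_not_eq. now apply Rmult_lt_0_compat.
    - replace (u x + - (s / 2) + s) with (v + s) by (unfold v; ring).
      transitivity (t / (k * g) * ((u x ^ 3 - u x + c) + 2 * u1 x ^ 2 * (v + s) / (2 * g ^ 2))).
      { rewrite <- Hk. field. lra. }
      rewrite Hu2, Hsq, <- Hg.
      transitivity (t ^ 2 * (- v * g) / (2 * t * k)); [field; lra|].
      rewrite Ht. field. lra. }
  (* The factor [kappa] in the argument of [arcsinh] is chosen for this: [G2] cancels and
     [(P - u) * (u - Q) + kappa] is [A v]. *)
  assert (Hr2 : (sqrt 2 * u1 x / sqrt (kappa * G2 v)) ^ 2 + 1 = A v / kappa).
  { fold t. rewrite sqrt_mult by lra. fold k g.
    transitivity (t ^ 2 * u1 x ^ 2 / (k ^ 2 * g ^ 2) + 1); [field; lra|].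
    rewrite Ht, Hsq, Hk, Hg, HuA. field. lra. }
  replace (s * rho x) with
    (u x + sqrt 2 * (- v * sqrt (G2 v) / (sqrt 2 * sqrt kappa) * / sqrt (A v / kappa))).
  - apply (is_derive_plus (fun x => RInt u 0 x)); [apply HU|].
    apply (is_derive_scal (fun x => arcsinh (sqrt 2 * u1 x / sqrt (kappa * G2 (u x - s / 2))))).
    apply (is_derive_comp arcsinh); [|exact Hr].
    rewrite <- Hr2. apply is_derive_Reals, derivable_pt_lim_arcsinh.
  - fold t k g. rewrite sqrt_div_alt by trivial. fold k.
    unfold rho. fold v g. set (a := sqrt (A v)).
    assert (Ha0 : 0 < a) by now apply sqrt_lt_R0.
    assert (Hav : a ^ 2 - g ^ 2 = 2 * s * v).
    { rewrite Hg. unfold a. rewrite pow2_sqrt by lra. unfold A. ring. }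
    replace (u x) with (s / 2 + v) by (unfold v; ring).
    (* Rationalizing [a - g] brings out the factor [s] and leaves a positive [rho]. *)
    transitivity (s / 2 + v * (a ^ 2 - g ^ 2) / (a * (a + g))); [field; lra|].
    rewrite Hav. field. lra. }
destruct (is_derive_Rolle Phi (fun x => s * rho x) 0 L HPhi HL) as [xi Hxi].
{ unfold Phi. rewrite HUL, <- (Hp 0), <- (Hp1 0), !Rplus_0_l. reflexivity. }
assert (Hs : s = 0).
{ apply Rmult_integral in Hxi. destruct Hxi as [|Hxi]; trivial. exfalso.
  enough (0 < rho xi) by lra. unfold rho.
  apply Rplus_lt_le_0_compat; [lra|].
  assert (HsA := sqrt_lt_R0 _ (HApos xi)). assert (HsG := sqrt_lt_R0 _ (HG2 xi)).
  apply Rle_mult_inv_pos; [|apply Rmult_lt_0_compat; lra].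
  assert (H := pow2_ge_0 (u xi - s / 2)). lra. }
assert (HQe : Q = - P) by (unfold s in Hs; lra).
rewrite Hs in Hc.
assert (Hc0 : c = 0) by lra.
split; trivial. rewrite HQe in *.
assert (HP0 : 0 < P) by lra. assert (HP1 : P ^ 2 < 1) by lra.
assert (HP2 : 0 < P ^ 2) by nra.
(* The first integral at the maximum with [c = 0]; here [1 - e4 = (1 - P ^ 2) ^ 2] and
   [e4 - P ^ 2 = P ^ 2 * (1 - P ^ 2)]. *)
exists (2 * P ^ 2 - P ^ 4). split; [|split].
- split; nra.
- intros x. specialize (HP x). specialize (HQ' x).
  assert (u x ^ 2 <= P ^ 2) by nra. nra.
- intros x. specialize (HfiP x). rewrite Hc0 in HfiP. lra.
Qed.

(** * The linear equation around an orbit with [c = 0] *)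

Lemma kernel_multiple_of_derivative (L : R) (u u1 w w1 : R -> R) (e4 d : R) :
  0 < L -> (forall x, is_derive u x (u1 x)) ->
  (forall x, is_derive u1 x (u x ^ 3 - u x)) ->
  (forall x, is_derive w x (w1 x)) ->
  (forall x, is_derive w1 x ((3 * u x ^ 2 - 1) * w x + d)) ->
  periodic L u -> periodic L u1 -> nonconstant u ->
  0 < e4 < 1 -> (forall x, u x ^ 2 < e4) ->
  (forall x, 2 * u1 x ^ 2 = u x ^ 4 - 2 * u x ^ 2 + e4) ->
  periodic L w -> average L w = 0 -> exists k, forall x, w x = k * u1 x.
Proof.
intros HL Hu Hu1 Hw Hw1 Hpu Hpu1 Hnc He Hue Hfi Hpw Haw.
set (D := d / (1 - e4)).
set (S := fun x => RInt (fun t => u t ^ 2) 0 x - e4 * x).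
assert (HS : forall x, is_derive S x (u x ^ 2 - e4)).
{ intros x. apply (is_derive_minus (fun x => RInt (fun t => u t ^ 2) 0 x)).
  - apply is_derive_primitive. intros t. apply (ex_derive_continuous (fun t => u t ^ 2)).
    auto_derive. eexists; apply Hu.
  - derive_known. ring. }
set (zeta := fun x => S x * u1 x - u x ^ 3 + (2 - e4) * u x).
set (zeta1 := fun x => S x * (u x ^ 3 - u x) - 2 * u x ^ 2 * u1 x + (2 - 2 * e4) * u1 x).
(* Subtracting the particular solution leaves a solution of the homogeneous equation. *)
set (z := fun x => w x - D * (1 - u x ^ 2)).
set (z1 := fun x => w1 x + 2 * D * u x * u1 x).
assert (Hh : forall x, 2 * u1 x ^ 2 - (u x ^ 4 - 2 * u x ^ 2 + e4) = 0).
{ intros x. rewrite Hfi. ring. }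
assert (HD : d = D * (1 - e4)) by (unfold D; field; lra).
assert (HK : forall x y, u1 x * z1 x - (u x ^ 3 - u x) * z x
                     = u1 y * z1 y - (u y ^ 3 - u y) * z y).
{ apply (is_derive_0_const (fun x => u1 x * z1 x - (u x ^ 3 - u x) * z x)).
  intros x. unfold z, z1. derive_known. rewrite HD.
  (* The derivative is [D * u1 x] times the left side of [Hh]; writing [0] as that multiple leaves a
     polynomial identity. *)
  rewrite <- (Rmult_0_r (D * u1 x)), <- (Hh x). ring. }
assert (HM : forall x y, zeta x * z1 x - zeta1 x * z x
                     = zeta y * z1 y - zeta1 y * z y).
{ apply (is_derive_0_const (fun x => zeta x * z1 x - zeta1 x * z x)).
  intros x. unfold z, z1, zeta, zeta1. derive_known. rewrite HD.
  rewrite <- (Rmult_0_r (D * zeta x + 2 * u x * z x)), <- (Hh x).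
  unfold z, zeta. ring. }
set (K := u1 0 * z1 0 - (u 0 ^ 3 - u 0) * z 0).
set (M := zeta 0 * z1 0 - zeta1 0 * z 0).
(* [N] is the Wronskian of [u1] and [zeta], [K] that of [u1] and [z], [M] that of
   [zeta] and [z]; Cramer's rule then expresses [z]. *)
set (N := e4 * (1 - e4)).
assert (HN : 0 < N) by (apply Rmult_lt_0_compat; lra).
assert (Hcramer : forall x, N * z x = K * zeta x - M * u1 x).
{ intros x. unfold K, M. rewrite (HK 0 x), (HM 0 x).
  transitivity (z x * (u1 x * zeta1 x - (u x ^ 3 - u x) * zeta x)); [|ring].
  rewrite Rmult_comm. f_equal. unfold N, zeta, zeta1. 
  apply Rminus_diag_uniq_sym. rewrite <- (Rmult_0_r (1 - e4 - u x ^ 2)), <- (Hh x). ring. }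
assert (HK0 : K = 0).
{ destruct (Req_dec K 0) as [|HKne]; trivial. exfalso. apply Hnc. exists (u 0).
  intros x. apply is_derive_0_const. intros y.
  enough (H : u1 y = 0) by (rewrite <- H; apply Hu).
  (* In Cramer's formula only [S] can change over a period, so periodicity of [z] gives
     [K * (S (y + L) - S y) * u1 y = 0]. *)
  assert (Hz : N * z (y + L) = N * z y) by (unfold z; now rewrite Hpw, Hpu).
  rewrite !Hcramer in Hz. unfold zeta in Hz. rewrite Hpu, Hpu1 in Hz.
  assert (HSy : K * (S (y + L) - S y) * u1 y = 0) by lra.
  apply Rmult_integral in HSy. destruct HSy as [HSy|]; trivial. exfalso.
  apply Rmult_integral in HSy. destruct HSy as [HSy|HSy]; [easy|].
  destruct (is_derive_Rolle S _ y (y + L) HS) as [xi Hxi]; [lra|lra|].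
  specialize (Hue xi). lra. }
assert (Hwu : forall x, w x = D * (1 - u x ^ 2) + - (M / N) * u1 x).
{ intros x. specialize (Hcramer x). rewrite HK0 in Hcramer.
  apply (Rmult_eq_reg_l N); [|lra]. unfold z in Hcramer.
  replace (N * (_ + _)) with (N * (D * (1 - u x ^ 2)) - M * u1 x) by (field; lra).
  lra. }
destruct (zero_average_primitive L w HL) as [HW HWL]; trivial.
{ intros x. apply (ex_derive_continuous w). eexists; apply Hw. }
(* This primitive of [D * (1 - u ^ 2)] agrees at [0] and [L], so its derivative has a zero, although
   [u ^ 2 < e4 < 1]. *)
destruct (is_derive_Rolle (fun x => RInt w 0 x + M / N * u x)
  (fun x => D * (1 - u x ^ 2)) 0 L) as [xi Hxi]; trivial.
{ intros x. replace (D * (1 - u x ^ 2)) with (w x + M / N * u1 x) by (rewrite Hwu; ring).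
  apply (is_derive_plus (fun x => RInt w 0 x)); [apply HW|].
  apply is_derive_scal, Hu. }
{ rewrite HWL, <- (Hpu 0), Rplus_0_l. reflexivity. }
assert (HD0 : D = 0).
{ specialize (Hue xi). apply Rmult_integral in Hxi. destruct Hxi; lra. }
exists (- (M / N)). intros x. rewrite (Hwu x), HD0. ring.
Qed.

(** * Reduction to second-order equations and conclusion *)

Lemma Derive_W (v : R) : Derive W v = v ^ 3 - v.
Proof. apply is_derive_unique. unfold W. auto_derive; trivial. field. Qed.

Lemma Derive_n_2_W (v : R) : Derive_n W 2 v = 3 * v ^ 2 - 1.
Proof.
change (Derive (Derive W) v = 3 * v ^ 2 - 1).
rewrite (Derive_ext _ _ v Derive_W).
apply is_derive_unique. auto_derive; trivial. ring.
Qed.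

Lemma Delta2_periodic_0 (L : R) (g : R -> R) :
  0 < L -> smooth g -> periodic L g -> (forall x, Delta2 g x = 0) ->
  exists c, forall x, g x = c.
Proof.
intros HL Hs Hp H. exists (g 0). intros x.
now apply (smooth_periodic_Derive_n_0 L 4).
Qed.

Lemma stationary_second_order (L : R) (u : R -> R) :
  0 < L -> smooth u -> periodic L u -> stationary_solution u ->
  exists c, forall x, Defs.Delta u x = u x ^ 3 - u x + c.
Proof.
intros HL Hs Hp Hsol.
destruct (Delta2_periodic_0 L (fun y => Defs.Delta u y - Derive W (u y))) as [c Hc]; trivial.
- apply (smooth_ext (fun y => Defs.Delta u y - (u y ^ 2 * u y - u y))).
  { intros y. rewrite Derive_W. ring. }
  apply smooth_minus; [now apply smooth_Delta|].
  apply smooth_minus; trivial. apply smooth_mult; trivial. now apply smooth_sqr.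
- intros x. now rewrite (periodic_Delta L u Hs Hp), Hp.
- exists c. intros x. specialize (Hc x). rewrite Derive_W in Hc. lra.
Qed.

Lemma linearized_second_order (L : R) (u w : R -> R) :
  0 < L -> smooth u -> periodic L u -> smooth w -> periodic L w ->
  (forall x, linearized u w x = 0) ->
  exists d, forall x, Defs.Delta w x = (3 * u x ^ 2 - 1) * w x + d.
Proof.
intros HL Hs Hp Hws Hwp Hw.
destruct (Delta2_periodic_0 L (fun y => Defs.Delta w y - Derive_n W 2 (u y) * w y))
  as [d Hd]; trivial.
- apply (smooth_ext (fun y => Defs.Delta w y - (3 * u y ^ 2 - 1) * w y)).
  { intros y. now rewrite Derive_n_2_W. }
  apply smooth_minus; [now apply smooth_Delta|].
  apply smooth_mult; trivial. apply smooth_minus; [|apply smooth_const].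
  now apply smooth_scal, smooth_sqr.
- intros x. now rewrite (periodic_Delta L w Hws Hwp), Hp, Hwp.
- exists d. intros x. specialize (Hd x). rewrite Derive_n_2_W in Hd. lra.
Qed.

Theorem theorem2p13 (L : R) (hL : 0 < L) (u : R -> R)
    (u_smooth : smooth u) (u_periodic : periodic L u)
    (u_nonconstant : nonconstant u) (u_average : average L u = 0)
    (u_solution : stationary_solution u) :
  forall w : R -> R,
    (smooth w /\ periodic L w /\ average L w = 0 /\
       forall x : R, linearized u w x = 0)
    <-> exists c : R, forall x : R, w x = c * Derive u x.
Proof.
destruct (stationary_second_order L u) as [c Hc]; trivial.
assert (Hu := smooth_is_derive u u_smooth).
assert (Hu1 : forall x, is_derive (Derive u) x (u x ^ 3 - u x + c)).
{ intros x. rewrite <- Hc. now apply is_derive_Delta. }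
assert (Hp1 := periodic_Derive L u u_smooth u_periodic).
intros w. split.
- intros (Hs & Hp & Ha & Hw).
  destruct (linearized_second_order L u w) as [d Hd]; trivial.
  destruct (zero_average_orbit L u (Derive u) c) as (Hc0 & e4 & He & Hue & Hfi); trivial.
  apply (kernel_multiple_of_derivative L u (Derive u) w (Derive w) e4 d); trivial.
  + intros x. replace (u x ^ 3 - u x) with (u x ^ 3 - u x + c) by (rewrite Hc0; ring).
    apply Hu1.
  + now apply smooth_is_derive.
  + intros x. rewrite <- Hd. now apply is_derive_Delta.
- intros [k Hk].
  assert (Hs : smooth w).
  { apply (smooth_ext (fun x => k * Derive u x)); [now intros|].
    now apply smooth_scal, smooth_Derive. }
  split; [trivial|split; [|split]].
  + intros x. now rewrite !Hk, Hp1.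
  + unfold average. rewrite (is_RInt_unique w 0 L (minus (k * u L) (k * u 0))).
    * rewrite <- (u_periodic 0), Rplus_0_l, minus_eq_zero. apply Rmult_0_r.
    * apply (is_RInt_derive (fun x => k * u x)).
      -- intros x _. rewrite Hk. apply is_derive_scal, Hu.
      -- intros x _. apply (ex_derive_continuous w).
         eexists. now apply smooth_is_derive.
  + intros x. unfold linearized, Delta2.
    (* The function under [Delta2] already vanishes: differentiating [u'' = u ^ 3 - u + c] shows
       that [u'] solves the linear equation with [d = 0]. *)
    rewrite (Derive_n_ext _ (fun _ => 0)).
    { now rewrite Derive_n_const. }
    intros y. rewrite Derive_n_2_W. unfold Defs.Delta. simpl.
    apply Rminus_diag_eq, is_derive_unique.
    apply (is_derive_ext (fun t => k * (u t ^ 3 - u t + c))).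
    * intros t. symmetry. apply (is_derive_unique w).
      apply (is_derive_ext (fun x => k * Derive u x)); [now intros|].
      apply is_derive_scal, Hu1.
    * derive_known. rewrite Hk. ring.
Qed.
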